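(* Let $p\ge0$ be an integer. Let $V$ be uniformly monotone on $\mathrm{dom}\,\psi$ of degree $p+2$ with parameter $\sigma_{p+2}$: $\langle V(x)-V(y),x-y\rangle\ge\sigma_{p+2}\|x-y\|^{p+2}$ for all $x,y\in\mathrm{dom}\,\psi$, and let $\|D^{p+1}V(x)\|^0\le\hat M_{p+1}$ for all $x\in\mathrm{dom}\,\psi$. Assume that $\kappa_{p+1}=\sigma_{p+2}/\hat M_{p+1}>0$ (with $\sigma_{p+2}>0$ and $0<\hat M_{p+1}<+\infty$). Let $M\ge\frac1{p!}\hat M_{p+1}$ and $$\hat\gamma_p=\Big(M-\tfrac{\hat M_{p+1}}{(p+1)!}\Big)\Big(M+\tfrac{\hat M_{p+1}}{(p+1)!}\Big)^{-\frac{p+2}{p+1}},\qquad \alpha_p=(p+2)\,\hat\gamma_p\Big(\tfrac1p\hat\gamma_p\Big)^{\frac{p}{p+2}}\sigma_{p+2}^{\frac{2}{p+2}},$$ where for $p=0$ the factor $(\frac1p\hat\gamma_p)^{p/(p+2)}$ is understood as $1$. Let $x_0\in\mathrm{dom}\,\psi$, $v_0=x_0$, and for $t\ge0$ let a) $x_{t+1}=V^p_M(v_t)$ and $V_\psi(x_{t+1})=V(x_{t+1})-G^M_{v_t,p}(x_{t+1})$ (assumed nonzero); b) $a_{t+1}=\langle V_\psi(x_{t+1}),v_t-x_{t+1}\rangle/\|V_\psi(x_{t+1})\|_*^2$ and $\hat v_{t+1}=\arg\min_{x\in\mathrm{dom}\,\psi}\{a_{t+1}\langle V_\psi(x_{t+1}),x-v_t\rangle+\frac12\|x-v_t\|^2\}$;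 c) $v_{t+1}=\frac1{1+\alpha_p}(\hat v_{t+1}+\alpha_p x_{t+1})$. Then, for the solution $x^*$ of the composite variational inequality, $$\|v_t-x^*\|\le\Big(\frac{1}{1+\alpha_p}\Big)^{t/2}\|x_0-x^*\|,\qquad t\ge0.$$
   Context: $\mathbb{E}$ is a finite-dimensional real vector space with dual $\mathbb{E}^*$; $B:\mathbb{E}\to\mathbb{E}^*$ is a self-adjoint positive definite linear operator, $\|x\|=\langle Bx,x\rangle^{1/2}$, $\|g\|_*=\langle g,B^{-1}g\rangle^{1/2}$. $\psi$ is a proper closed convex function on $\mathbb{E}$; $V$ is an operator with values in $\mathbb{E}^*$, $p+1$ times continuously differentiable (on an open set containing $\mathrm{dom}\,\psi$). For a symmetric $k$-linear form $A:\mathbb{E}^k\to\mathbb{E}^*$, $\|A\|^0=\max\{\|A[h_1,\dots,h_k]\|_*:\|h_i\|\le1\}$. Composite variational inequality: find $x^*\in\mathrm{dom}\,\psi$ with $\langle V(x),x-x^*\rangle+\psi(x)\ge\psi(x^* )$ for all $x\in\mathrm{dom}\,\psi$ (a solution is assumed to exist; it is unique under uniform monotonicity; since $V$ is continuous, equivalently $\langle V(x^* ),x-x^*\rangle+\psi(x)\ge\psi(x^* )$ for all $x\in\mathrm{dom}\,\psi$). Tensor step: $\mathcal{T}^V_{v,p}(y)=\sum_{i=0}^p\frac1{i!}D^iV(v)[y-v]^i$ (for $p=0$ it is the constant $V(v)$), $G^M_{v,p}(y)=\mathcal{T}^V_{v,p}(y)+M\|y-v\|^{p}B(y-v)$. $V_M^p(v)$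 denotes a point $x_+\in\mathrm{dom}\,\psi$ such that $\langle G^M_{v,p}(x_+),y-x_+\rangle+\psi(y)\ge\psi(x_+)$ for all $y\in\mathrm{dom}\,\psi$. All points defined by the auxiliary problems are assumed to exist. *)

(* Defs.v *)
From HB Require Import structures.
From mathcomp Require Import all_boot all_order all_algebra.
From mathcomp Require Import all_classical all_reals all_analysis.

Set Implicit Arguments.
Unset Strict Implicit.
Unset Printing Implicit Defensive.

Import Order.TTheory GRing.Theory Num.Theory.
Import numFieldNormedType.Exports.

Local Open Scope classical_set_scope.
Local Open Scope ring_scope.

(* A finite-dimensional real vector space with its canonical topology.  The
   norm below (the sup norm in some basis) is only used to define topology and
   differentiability, which do not depend on the choice of a norm; it is
   unrelated to the Euclidean norm [bnorm] attached to an operator [B]. *)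
Definition topvect (R : realType) (E : vectType R) : Type := E.

HB.instance Definition _ (R : realType) (E : vectType R) :=
  Vector.copy (topvect E) E.

Section TopVectNorm.
Import VectorInternalTheory.
Context (R : realType) (E : vectType R).

Definition topvect_norm (x : topvect E) : R := `|v2r (x : E)|.

Lemma topvect_normD x y :
  topvect_norm (x + y) <= topvect_norm x + topvect_norm y.
Proof. by rewrite /topvect_norm (linearD v2r) ler_normD. Qed.

Lemma topvect_normZ (l : R) x : topvect_norm (l *: x) = `|l| * topvect_norm x.
Proof. by rewrite /topvect_norm (linearZ_LR v2r) normrZ. Qed.

Lemma topvect_norm0_eq0 x : topvect_norm x = 0 -> x = 0.
Proof.
by move=> /normr0_eq0 x0; apply: (can_inj v2rK); rewrite x0 linear0.
Qed.

End TopVectNorm.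

HB.instance Definition _ (R : realType) (E : vectType R) :=
  Lmodule_isNormed.Build R (topvect E)
    (@topvect_normD R E) (@topvect_normZ R E) (@topvect_norm0_eq0 R E).

Section Derivatives.
Context (R : realType) (E F : vectType R).

(* [mlin k] is the space L(E, L(E, ... L(E, F))) of curried [k]-linear maps. *)
Fixpoint mlin (k : nat) : vectType R :=
  if k is k'.+1 then 'Hom(E, mlin k') else F.

Fixpoint meval (k : nat) : mlin k -> ('I_k -> E) -> F :=
  match k return mlin k -> ('I_k -> E) -> F with
  | 0 => fun A _ => A
  | k'.+1 => fun A h =>
      meval ((A : 'Hom(E, mlin k')) (h ord0)) (fun i => h (lift ord0 i))
  end.

(* ['d] is total: [Diter k f x] is the k-th Fréchet derivative only where the
   lower-order ones are differentiable, which [Ck_on] guarantees on [U]. *)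
Fixpoint Diter (k : nat) (f : E -> F) : E -> mlin k :=
  match k return E -> mlin k with
  | 0 => f
  | k'.+1 => fun x =>
      linfun ('d (Diter k' f : topvect E -> topvect (mlin k')) (x : topvect E)
              : E -> mlin k')
  end.

Definition Ck_on (k : nat) (U : set E) (f : E -> F) : Prop :=
  (forall i, (i < k)%N -> forall x : topvect E, U x ->
     differentiable (Diter i f : topvect E -> topvect (mlin i)) x) /\
  (forall x : topvect E, U x ->
     {for x, continuous (Diter k f : topvect E -> topvect (mlin k))}).

End Derivatives.
Arguments Diter {R E F} k f x.
Arguments meval {R E F k} A h.

Definition dual (R : realType) (E : vectType R) : vectType R := 'Hom(E, R^o).

Definition pairing (R : realType) (E : vectType R) (g : dual E) (x : E) : R :=
  (g : 'Hom(E, R^o)) x.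

Section Geometry.
Context (R : realType) (E : vectType R) (B : 'Hom(E, dual E)).

Definition self_adjoint : Prop :=
  forall x y : E, pairing (B x) y = pairing (B y) x.

Definition positive_definite : Prop :=
  forall x : E, x != 0 -> 0 < pairing (B x) x.

Definition bnorm (x : E) : R := Num.sqrt (pairing (B x) x).

(* [B^-1] is the genuine inverse as soon as [B] is positive definite. *)
Definition dnorm (g : dual E) : R := Num.sqrt (pairing g ((B^-1)%VF g)).

(* The supremum is a maximum, the unit ball being compact. *)
Definition opnorm (k : nat) (A : mlin E (dual E) k) : \bar R :=
  ereal_sup [set (dnorm (meval A h))%:E |
             h in [set h : 'I_k -> E | forall i, bnorm (h i) <= 1]].

End Geometry.

Section ConvexFunctions.
Context (R : realType) (E : vectType R) (psi : E -> \bar R).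

Definition edom : set E := [set x | (psi x < +oo)%E].

Definition proper_function : Prop :=
  (forall x, (-oo < psi x)%E) /\ edom !=set0.

Definition epigraph : set (topvect E * R^o) :=
  [set z | (psi z.1 <= (z.2 : R)%:E)%E].

(* Closedness and convexity of a function are those of its epigraph. *)
Definition proper_closed_convex : Prop :=
  [/\ proper_function, closed epigraph &
      convex_set (epigraph : set (convex_lmodType (topvect E * R^o)%type))].

End ConvexFunctions.

Definition is_argmin_on (T : Type) (R : realType) (D : set T) (f : T -> R)
    (x : T) : Prop :=
  D x /\ forall y, D y -> f x <= f y.

Section CompositeVI.
Context (R : realType) (E : vectType R) (B : 'Hom(E, dual E))
        (psi : E -> \bar R) (V : E -> dual E).

Definition uniformly_monotone (q : nat) (sigma : R) : Prop :=
  forall x y, edom psi x -> edom psi y ->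
    sigma * bnorm B (x - y) ^+ q <= pairing (V x - V y) (x - y).

Definition composite_VI_solution (xs : E) : Prop :=
  edom psi xs /\
  forall x, edom psi x -> (psi xs <= (pairing (V x) (x - xs))%:E + psi x)%E.

Definition taylor (p : nat) (v y : E) : dual E :=
  \sum_(i < p.+1) (i`!%:R)^-1 *: meval (Diter i V v) (fun=> y - v).

Definition tensor_model (p : nat) (M : R) (v y : E) : dual E :=
  taylor p v y + (M * bnorm B (y - v) ^+ p) *: B (y - v).

Definition is_tensor_step (p : nat) (M : R) (v xp : E) : Prop :=
  edom psi xp /\
  forall y, edom psi y ->
    (psi xp <= (pairing (tensor_model p M v xp) (y - xp))%:E + psi y)%E.

Definition Vpsi (p : nat) (M : R) (v xp : E) : dual E :=
  V xp - tensor_model p M v xp.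

Definition step_size (p : nat) (M : R) (v xp : E) : R :=
  pairing (Vpsi p M v xp) (v - xp) / dnorm B (Vpsi p M v xp) ^+ 2.

Definition is_prox_step (p : nat) (M : R) (v xp vhat : E) : Prop :=
  is_argmin_on (edom psi)
    (fun x => step_size p M v xp * pairing (Vpsi p M v xp) (x - v)
              + 2^-1 * bnorm B (x - v) ^+ 2)
    vhat.

End CompositeVI.

Definition gamma_hat (R : realType) (p : nat) (M Mhat : R) : R :=
  (M - Mhat / (p.+1)`!%:R) *
  (M + Mhat / (p.+1)`!%:R) `^ (- (p.+2%:R / p.+1%:R)).

Definition alpha (R : realType) (p : nat) (M Mhat sigma : R) : R :=
  p.+2%:R * gamma_hat p M Mhat *
  (if p == 0%N then 1
   else (p%:R^-1 * gamma_hat p M Mhat) `^ (p%:R / p.+2%:R)) *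
  sigma `^ (2 / p.+2%:R).

(* Main.v *)
Require Import Defs.
From HB Require Import structures.
From mathcomp Require Import all_boot all_order all_algebra.
From mathcomp Require Import all_classical all_reals all_analysis.
From mathcomp Require Import zify ring lra.

Set Implicit Arguments.
Unset Strict Implicit.
Unset Printing Implicit Defensive.

Import Order.TTheory GRing.Theory Num.Theory.
Import numFieldNormedType.Exports.

Local Open Scope classical_set_scope.
Local Open Scope ring_scope.

(* Write g for [Vpsi] at x_{t+1} and D = |x_{t+1} - x^*|.  The Taylor bound
   |V(x_{t+1}) - T(x_{t+1})|_* <= Mhat/(p+1)! |x_{t+1} - v_t|^(p+1) gives
   <g, v_t - x_{t+1}> >= gamma_hat |g|_*^((p+2)/(p+1)); since g is a value of
   V + psi' at x_{t+1}, uniform monotonicity and the Minty form of the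
   inequality at x^* give <g, x_{t+1} - x^*> >= sigma D^(p+2).  Strong convexity
   of the proximal subproblem then yields
     |vhat_{t+1} - x^*|^2 <= |v_t - x^*|^2 - (2 a sigma D^(p+2) + a^2 |g|_*^2),
   the last bracket is at least alpha D^2 by weighted AM-GM, and averaging
   vhat_{t+1} with x_{t+1} trades alpha D^2 for the contraction factor. *)

(** * Euclidean geometry of [B] and of the dual norm *)

Section Euclid.
Context (R : realType) (E : vectType R).

Lemma pairing_is_linear (g : dual E) : linear (pairing g : E -> R^o).
Proof. by move=> a x y; rewrite /pairing linearP. Qed.
HB.instance Definition _ g :=
  GRing.isLinear.Build R E R^o _ (pairing g) (pairing_is_linear g).

Lemma pairingDl (f g : dual E) x :
  pairing (f + g) x = pairing f x + pairing g x.
Proof. by rewrite /pairing add_lfunE. Qed.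

Lemma pairingNl (g : dual E) x : pairing (- g) x = - pairing g x.
Proof. by rewrite /pairing opp_lfunE. Qed.

Lemma pairingZl a (g : dual E) x : pairing (a *: g) x = a * pairing g x.
Proof. by rewrite /pairing scale_lfunE. Qed.

Lemma pairingDr (g : dual E) x y :
  pairing g (x + y) = pairing g x + pairing g y.
Proof. exact: linearD. Qed.

Lemma pairingNr (g : dual E) x : pairing g (- x) = - pairing g x.
Proof. exact: linearN. Qed.

Lemma pairingZr a (g : dual E) x : pairing g (a *: x) = a * pairing g x.
Proof. exact: linearZ. Qed.

Definition pairingE :=
  (pairingDl, pairingNl, pairingZl, pairingDr, pairingNr, pairingZr).

Lemma pairing_suml (I : finType) (F : I -> dual E) x :
  pairing (\sum_i F i) x = \sum_i pairing (F i) x.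
Proof. by rewrite /pairing sum_lfunE. Qed.

Context (B : 'Hom(E, dual E)).
Hypothesis B_self_adjoint : self_adjoint B.
Hypothesis B_posdef : positive_definite B.

Lemma lfunD x y : B (x + y) = B x + B y. Proof. exact: linearD. Qed.
Lemma lfunZ a x : B (a *: x) = a *: B x. Proof. exact: linearZ. Qed.

Lemma pairing_ge0 x : 0 <= pairing (B x) x.
Proof.
have [->|/B_posdef/ltW//] := eqVneq x 0.
by rewrite /pairing linear0.
Qed.

Lemma bnorm_ge0 x : 0 <= bnorm B x. Proof. exact: sqrtr_ge0. Qed.

Lemma bnorm_sqr x : bnorm B x ^+ 2 = pairing (B x) x.
Proof. by rewrite sqr_sqrtr// pairing_ge0. Qed.

Lemma bnormZ a x : bnorm B (a *: x) = `|a| * bnorm B x.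
Proof.
rewrite /bnorm lfunZ pairingZl pairingZr mulrA -expr2 sqrtrM ?sqr_ge0//.
by rewrite sqrtr_sqr.
Qed.

Lemma bnormN x : bnorm B (- x) = bnorm B x.
Proof. by rewrite -scaleN1r bnormZ normrN normr1 mul1r. Qed.

Lemma bnorm_eq0 x : bnorm B x = 0 -> x = 0.
Proof.
move=> x0; apply/eqP; apply: contraT => /B_posdef.
by rewrite -bnorm_sqr x0 expr0n/= ltxx.
Qed.

Lemma bnorm_sqrD x y :
  bnorm B (x + y) ^+ 2 = bnorm B x ^+ 2 + pairing (B x) y *+ 2 + bnorm B y ^+ 2.
Proof.
rewrite !bnorm_sqr lfunD !pairingE (B_self_adjoint y x).
by ring.
Qed.

Lemma bnorm_sqrZ a x : bnorm B (a *: x) ^+ 2 = a ^+ 2 * bnorm B x ^+ 2.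
Proof. by rewrite bnormZ exprMn real_normK ?num_real. Qed.

(** For y nonzero, the squared norm of <By,y> x - <Bx,y> y is <By,y> (<Bx,x><By,y> - <Bx,y>^2), and
    the first factor is positive. *)
Lemma cauchy_schwarz x y : `|pairing (B x) y| <= bnorm B x * bnorm B y.
Proof.
have [->|y0] := eqVneq y 0.
  by rewrite (linear0 (pairing (B x))) normr0 mulr_ge0 ?bnorm_ge0.
have y_gt0 := B_posdef y0.
rewrite -(ler_pXn2r (n := 2)) ?nnegrE ?mulr_ge0 ?bnorm_ge0 ?normr_ge0//.
rewrite real_normK ?num_real// exprMn.
have := sqr_ge0 (bnorm B (pairing (B y) y *: x - pairing (B x) y *: y)).
rewrite bnorm_sqrD bnormN !bnorm_sqrZ lfunZ !pairingE !bnorm_sqr.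
set a := pairing (B y) y in y_gt0 *; set b := pairing (B x) y.
set c := pairing (B x) x.
rewrite [X in 0 <= X -> _](_ : _ = a * (c * a - b ^+ 2)); last by ring.
by rewrite pmulr_rge0// subr_ge0.
Qed.

(** Positive definiteness makes the kernel trivial, and the dual has the dimension of E; so [B] is
    onto and its pseudo-inverse is a right inverse. *)
Lemma mulBV (g : dual E) : B ((B^-1)%VF g) = g.
Proof.
apply: limg_lfunVK.
suff -> : limg B = fullv by exact: memvf.
have kerB : (fullv :&: lker B = 0)%VS.
  apply/eqP; rewrite -subv0; apply/subvP => x; rewrite memv_cap memv_ker.
  move=> /andP[_ /eqP Bx0]; rewrite memv0; apply: contraT => /B_posdef.
  by rewrite Bx0 /pairing lfunE/= ltxx.
have := limg_ker_dim B fullv; rewrite kerB dimv0 add0n => dimB.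
by apply/eqP; rewrite eqEdim subvf/= dimB !dimvf /dim/= muln1.
Qed.

Lemma dnormE (g : dual E) : dnorm B g = bnorm B ((B^-1)%VF g).
Proof. by rewrite /dnorm /bnorm mulBV. Qed.

Lemma dualnorm_ge0 (g : dual E) : 0 <= dnorm B g. Proof. exact: sqrtr_ge0. Qed.

Lemma dualnorm_gt0 (g : dual E) : g != 0 -> 0 < dnorm B g.
Proof.
move=> g0; rewrite lt_neqAle dualnorm_ge0 andbT eq_sym.
apply: contra g0 => /eqP.
by rewrite dnormE => /bnorm_eq0 w0; rewrite -(mulBV g) w0 linear0.
Qed.

Lemma pairing_le_dnorm (g : dual E) x : `|pairing g x| <= dnorm B g * bnorm B x.
Proof. by rewrite -{1}(mulBV g) dnormE cauchy_schwarz. Qed.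

(** Test the hypothesis at B^-1 g: the pairing is the square of the dual norm, and one factor
    cancels unless it is zero. *)
Lemma dualnorm_le (g : dual E) C : 0 <= C ->
  (forall x, pairing g x <= C * bnorm B x) -> dnorm B g <= C.
Proof.
move=> C0 gC; have := gC ((B^-1)%VF g).
rewrite -{1}(mulBV g) -bnorm_sqr -dnormE expr2.
have [->//|g0] := eqVneq (dnorm B g) 0.
by rewrite ler_pM2r// lt_neqAle eq_sym g0 dualnorm_ge0.
Qed.

End Euclid.

(** * Derivatives along a line *)

Section LineDerivative.
Import VectorInternalTheory.
Context (R : realType).

Lemma mx_entry_le_norm n (w : 'rV[R]_n) i : `|w 0 i| <= `|w|.
Proof.
rewrite /Num.Def.normr/= mx_normrE.
exact: (le_bigmax_cond _ (fun j : 'I_1 * 'I_n => `|w j.1 j.2|) (j := (0, i))).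
Qed.

(** Expanding x in coordinates gives |l x| <= (sum_i |l e_i|) |x|, each coordinate being at most the
    sup norm. *)
Lemma topvect_linear_continuous (E : vectType R) (W : normedModType R)
  (l : {linear topvect E -> W}) : continuous l.
Proof.
apply: bounded_linear_continuous; apply/linear_boundedP.
pose e i : topvect E := r2v (delta_mx 0 i).
near=> r => x.
have -> : l x = \sum_i (v2r (x : E)) 0 i *: l (e i).
  rewrite -[in LHS](v2rK (x : E)) [in LHS](row_sum_delta (v2r (x : E))).
  rewrite (linear_sum r2v) (linear_sum l); apply: eq_bigr => i _.
  by rewrite (linearZ_LR r2v) linearZ.
apply: (@le_trans _ _ ((\sum_i `|l (e i)|) * `|x|)).
  rewrite mulr_suml; apply: (le_trans (ler_norm_sum _ _ _)).
  apply: ler_sum => i _; rewrite normrZ mulrC ler_wpM2l//.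
  exact: mx_entry_le_norm.
by rewrite ler_wpM2r//; near: r; apply: nbhs_pinfty_ge; rewrite num_real.
Unshelve. all: by end_near. Qed.

(** Chain rule: the line has differential s -> s h, and l, being linear and continuous, is its own
    differential. *)
Lemma is_derive_line (E F : vectType R) (f : topvect E -> topvect F)
    (l : {linear topvect F -> R^o}) (v h : topvect E) (s : R) :
  differentiable f (v + s *: h) ->
  is_derive s (1 : R) (fun s : R => l (f (v + s *: h)) : R^o)
    (l ('d f (v + s *: h) h)).
Proof.
move=> df.
pose g : R -> topvect E := cst v + *:%R ^~ h.
have dg : is_diff s g (0 + *:%R ^~ h) by exact: is_diffD.
have dl : is_diff (f (g s)) l l.
  apply: DiffDef; first exact/linear_differentiable/topvect_linear_continuous.
  by rewrite diff_lin//; exact: topvect_linear_continuous.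
have dfg : is_diff (g s) f ('d f (g s)) by exact: differentiableP.
have dc : is_diff s (l \o (f \o g)) (l \o ('d f (g s) \o (0 + *:%R ^~ h))).
  exact: is_diff_comp.
apply: DeriveDef; first exact/diff_derivable/ex_diff.
by rewrite deriveE ?diff_val//= /GRing.add/= add0r scale1r.
Qed.

End LineDerivative.

(** * A one-sided Taylor bound in one real variable *)

Section Taylor.
Context (R : realType).

Lemma is_derive_monomial (n : nat) (s : R) :
  is_derive s (1 : R) (fun s : R => s ^+ n.+1 / n.+1`!%:R : R^o)
    (s ^+ n / n`!%:R).
Proof.
have -> : (fun s : R => s ^+ n.+1 / n.+1`!%:R : R^o) =
    (n.+1`!%:R^-1 : R) *: ((id : R -> R^o) ^+ n.+1).
  apply/funext => z; rewrite mulrC /GRing.scale/=; congr (_ * _).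
  by rewrite exprfctE.
apply: is_derive_eq.
rewrite factS natrM invfM /GRing.scale/= mulr1 [LHS]mulrC.
by rewrite mulrACA divff ?pnatr_eq0// mul1r.
Qed.

(** Here [f i] stands for the i-th derivative of [f 0]. Induction on [n]: removing from [f 0] the
    Taylor terms of positive order and the claimed bound leaves a function whose derivative is
    nonpositive, by the induction hypothesis for the shifted sequence; the mean value theorem
    concludes. *)
Lemma taylor_mean_le (f : nat -> R -> R) (n : nat) (C : R) :
  (forall i (s : R), (i < n)%N -> 0 <= s <= 1 ->
     is_derive s (1 : R) (f i : R -> R^o) (f i.+1 s)) ->
  (forall s : R, 0 <= s <= 1 -> f n s <= C) ->
  forall s : R, 0 <= s <= 1 ->
    f 0%N s - \sum_(i < n) f i 0 * (s ^+ i / i`!%:R) <= C * (s ^+ n / n`!%:R).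
Proof.
elim: n f => [|n IH] f df fC s s01.
  by rewrite big_ord0 subr0 expr0 fact0 invr1 !mulr1 fC.
pose m i (s : R) : R^o := s ^+ i.+1 / i.+1`!%:R.
pose g : R -> R^o := f 0%N - (\sum_(i < n) (f i.+1 0) *: m i) - C *: m n.
pose dg s := f 1%N s - (\sum_(i < n) (f i.+1 0) *: (s ^+ i / i`!%:R : R^o))
               - C *: (s ^+ n / n`!%:R : R^o).
have dgE (c : R) : 0 <= c <= 1 -> is_derive c (1 : R) g (dg c).
  move=> c01; apply: is_deriveB; last first.
    exact/is_deriveZ/is_derive_monomial.
  apply: is_deriveB; first exact: df.
  by apply: is_derive_sum => i; exact/is_deriveZ/is_derive_monomial.
have [s0 s1] := andP s01.
have in01 c : c \in `[0, s] -> 0 <= c <= 1.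
  by rewrite in_itv/= => /andP[-> /le_trans]; exact.
have [||c cs] := @MVT_segment _ g dg 0 s s0.
- by move=> c /subset_itv_oo_cc /in01/dgE.
- apply: derivable_within_continuous => c /in01/dgE[]//.
rewrite subr0 => gs.
have : g s - g 0 <= 0.
  rewrite gs mulr_le0_ge0// /dg subr_le0.
  have := IH (fun i => f i.+1) (fun i t H => df i.+1 t H) fC c (in01 _ cs).
  exact.
have gE z : g z = f 0%N z - \sum_(i < n) f i.+1 0 * (z ^+ i.+1 / i.+1`!%:R)
    - C * (z ^+ n.+1 / n.+1`!%:R).
  by rewrite /g !(addrfctE, opprfctE) fct_sumE.
have -> : g 0 = f 0%N 0.
  rewrite gE big1 => [|i _]; last by rewrite exprS !mul0r mulr0.
  by rewrite exprS !mul0r mulr0 !subr0.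
rewrite gE big_ord_recl expr0 fact0 invr1 !mulr1 => h.
rewrite -subr_le0. move: h. lra.
Qed.

End Taylor.

(** * Taylor remainder of the operator *)

Section TaylorOperator.
Context (R : realType) (E : vectType R).

Lemma meval_is_linear (F : vectType R) k (h : 'I_k -> E) :
  linear (fun A : mlin E F k => meval A h).
Proof.
elim: k h => [//|k IH] h a A A' /=.
by rewrite add_lfunE scale_lfunE IH.
Qed.

Lemma mevalZ (F : vectType R) k (A : mlin E F k) a (h : 'I_k -> E) :
  meval (a *: A) h = a *: meval A h.
Proof. by elim: k A h => [//|k IH] A h /=; rewrite scale_lfunE IH. Qed.

Lemma meval_scale (F : vectType R) k (A : mlin E F k) a (h : E) :
  meval A (fun=> a *: h) = a ^+ k *: meval A (fun=> h).
Proof.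
elim: k A => [|k IH] A /=; first by rewrite scale1r.
by rewrite IH [A _]linearZ mevalZ scalerA -exprSr.
Qed.

(** Where [V] is smooth enough, this is the i-th derivative of the real function s -> <V(v + s h),
    u>. *)
Definition directional (V : E -> dual E) (v h u : E) i (s : R) : R :=
  pairing (meval (Diter i V (v + s *: h)) (fun=> h)) u.

Lemma is_derive_directional (V : E -> dual E) (v h u : E) i (s : R) :
  differentiable (Diter i V : topvect E -> topvect (mlin E (dual E) i))
    (v + s *: h : topvect E) ->
  is_derive s (1 : R) (directional V v h u i : R -> R^o)
    (directional V v h u i.+1 s).
Proof.
move=> dV.
pose l (A : topvect (mlin E (dual E) i)) : R^o := pairing (meval A (fun=> h)) u.
have l_lin : linear l.
  by move=> a A A'; rewrite /l meval_is_linear pairingDl pairingZl.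
pose lM := GRing.isLinear.Build _ _ _ _ l l_lin.
pose lL : {linear topvect (mlin E (dual E) i) -> R^o} := HB.pack l lM.
have := @is_derive_line R E (mlin E (dual E) i) _ lL v h s dV.
by rewrite /directional /= lfunE.
Qed.

Context (B : 'Hom(E, dual E)).
Hypothesis B_self_adjoint : self_adjoint B.
Hypothesis B_posdef : positive_definite B.

(** Homogeneity of degree k carries the bound from the unit ball to h. *)
Lemma meval_diag_le k (A : mlin E (dual E) k) (C : R) (h : E) :
  (opnorm B A <= C%:E)%E ->
  dnorm B (meval A (fun=> h)) <= C * bnorm B h ^+ k.
Proof.
move=> AC; set r := bnorm B h.
(* When r = 0, definiteness forces h = 0 and both sides vanish. *)
have hE : h = r *: (r^-1 *: h).
  rewrite scalerA; have [r0|r0] := eqVneq r 0; last by rewrite divff ?scale1r.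
  by rewrite r0 mul0r scale0r; exact: bnorm_eq0 r0.
rewrite {1}hE meval_scale /dnorm pairingZl [X in pairing _ X]linearZ/=.
rewrite pairingZr mulrA -expr2 sqrtrM ?sqr_ge0// sqrtr_sqr normrX.
rewrite ger0_norm ?bnorm_ge0//.
rewrite mulrC ler_wpM2r ?exprn_ge0 ?bnorm_ge0// -lee_fin.
apply: le_trans AC; apply: ereal_sup_ubound.
exists (fun=> r^-1 *: h) => // i; rewrite bnormZ normfV ger0_norm ?bnorm_ge0//.
have [->|r0] := eqVneq r 0; first by rewrite invr0 mul0r ler01.
by rewrite mulVf.
Qed.

(** Pairing with an arbitrary u reduces the claim to the one-variable bound at s = 1 with constant C
    |h|^(p+1) |u|; [dualnorm_le] then removes u. *)
Lemma taylor_remainder_le (V : E -> dual E) (U : set E) p (C : R) (v h : E) :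
  Ck_on p.+1 U V -> 0 <= C ->
  (forall s : R, 0 <= s <= 1 -> U (v + s *: h)) ->
  (forall s : R, 0 <= s <= 1 ->
     (opnorm B (Diter p.+1 V (v + s *: h)) <= C%:E)%E) ->
  dnorm B (V (v + h) - taylor V p v (v + h)) <=
    C / p.+1`!%:R * bnorm B h ^+ p.+1.
Proof.
move=> [dV _] C0 Uv VC; apply: dualnorm_le => // [|u].
  by rewrite !mulr_ge0 ?exprn_ge0 ?bnorm_ge0.
have T : directional V v h u 0 1 -
    \sum_(i < p.+1) directional V v h u i 0 * (1 ^+ i / i`!%:R) <=
    C * bnorm B h ^+ p.+1 * bnorm B u * (1 ^+ p.+1 / p.+1`!%:R).
  apply: taylor_mean_le => [i s ip s01|s s01|]; last by rewrite ler01 lexx.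
    by apply: is_derive_directional; apply: dV => //; exact: Uv.
  apply: le_trans (ler_norm _) _.
  apply: le_trans (pairing_le_dnorm _ _ _ _) _ => //.
  by rewrite ler_wpM2r ?bnorm_ge0// meval_diag_le// VC.
rewrite pairingDl pairingNl /taylor pairing_suml.
rewrite (eq_bigr (fun i : 'I_p.+1 =>
    directional V v h u i 0 * (1 ^+ i / i`!%:R))); last first.
  move=> i _; rewrite /directional scale0r addr0 addrC addKr pairingZl.
  by rewrite expr1n mul1r mulrC.
apply: le_trans (_ : _ <= C * bnorm B h ^+ p.+1 * bnorm B u / p.+1`!%:R) _.
  by rewrite {1}/directional /= scale1r [in leRHS]expr1n mul1r in T.
by rewrite le_eqVlt; apply/orP; left; apply/eqP; ring.
Qed.

End TaylorOperator.

(** * Variational inequalities and the proximal step *)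

Section VariationalInequalities.
Context (R : realType) (E : vectType R).

(** Limit step for the first-order arguments below: an inequality along a segment, once divided by s
    > 0, persists at s = 0. *)
Lemma continuous_ge0_at0 (f : R -> R) : {for 0, continuous f} ->
  (forall s, 0 < s <= 1 -> 0 <= f s) -> 0 <= f 0.
Proof.
move=> fc f_ge0.
have : f s @[s --> 0^'+] --> f 0 by exact: cvg_at_right_filter.
move=> /cvgr_to_ge; apply.
near=> s; apply: f_ge0; apply/andP; split.
  by near: s; exact: nbhs_right_gt.
by near: s; apply: nbhs_right_le; exact: ltr01.
Unshelve. all: by end_near. Qed.

Section Psi.
Context (psi : E -> \bar R).
Hypothesis psi_pcc : proper_closed_convex psi.

Lemma psi_fine x : edom psi x -> psi x = (fine (psi x))%:E.
Proof.
move=> xd; rewrite fineK// fin_numElt xd andbT.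
by case: psi_pcc => -[].
Qed.

Lemma psi_convex_le x y s : edom psi x -> edom psi y -> 0 <= s <= 1 ->
  (psi (x + s *: (y - x)) <=
     (fine (psi x) + s * (fine (psi y) - fine (psi x)))%:E)%E.
Proof.
move=> xd yd /andP[s0 s1].
have [_ _ cvx] := psi_pcc.
have := cvx (y, fine (psi y)) (x, fine (psi x)) (Itv01 s0 s1).
rewrite !inE /epigraph /= -!psi_fine// => /(_ (lexx _) (lexx _)).
rewrite /conv/= !(scalerBl, scalerBr) !scale1r.
congr (psi _ <= _%:E)%E.
  by rewrite addrC -addrA; congr (_ + _); rewrite addrC.
by rewrite /GRing.scale/=; ring.
Qed.

Lemma edom_convex x y s : edom psi x -> edom psi y -> 0 <= s <= 1 ->
  edom psi (x + s *: (y - x)).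
Proof. by move=> *; apply: le_lt_trans (psi_convex_le _ _ _) (ltry _). Qed.

(** The definition of a solution evaluates [V] at the moving point. Apply it at xs + s (x - xs),
    bound psi by convexity, divide by s and let s tend to 0. *)
Lemma minty (U : set E) (V : E -> dual E) p xs x :
  edom psi `<=` U -> Ck_on p.+1 U V -> composite_VI_solution psi V xs ->
  edom psi x -> fine (psi xs) <= pairing (V xs) (x - xs) + fine (psi x).
Proof.
move=> domU [dV _] [xsd xs_sol] xd; set h := x - xs.
pose f s := directional V xs h h 0 s + (fine (psi x) - fine (psi xs)).
have : 0 <= f 0.
  apply: (continuous_ge0_at0 (f := f)) => [|s /andP[s0 s1]].
    have dV0 : differentiable
        (Diter 0 V : topvect E -> topvect (mlin E (dual E) 0))
        (xs + (0 : R) *: h : topvect E).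
      by apply: dV => //; rewrite scale0r addr0; exact: domU.
    have [df _] := is_derive_directional h dV0.
    apply: cvgD; last exact: cvg_cst.
    exact/differentiable_continuous/derivable1_diffP.
  have s01 : 0 <= s <= 1 by rewrite ltW.
  have yd := edom_convex xsd xd s01.
  have := le_trans (xs_sol _ yd) (leeD2l _ (psi_convex_le xsd xd s01)).
  rewrite (psi_fine xsd) -EFinD lee_fin -/h addrAC subrr add0r pairingZr.
  rewrite /f /directional/= -(pmulr_rge0 _ s0). lra.
by rewrite /f /directional/= scale0r addr0; lra.
Qed.

End Psi.

(** With k = y - z, minimality of z along the segment to y gives a <g,k> + <B(z - v),k> >= 0 in the
    limit; expanding |(z - v) + k|^2 then yields the claim. *)
Lemma prox_step_ineq (B : 'Hom(E, dual E)) (D : set E) a (g : dual E) v z y :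
  self_adjoint B -> positive_definite B ->
  (forall x y s, D x -> D y -> 0 <= s <= 1 -> D (x + s *: (y - x))) ->
  is_argmin_on D
    (fun x => a * pairing g (x - v) + 2^-1 * bnorm B (x - v) ^+ 2) z ->
  D y ->
  bnorm B (y - z) ^+ 2 <= bnorm B (y - v) ^+ 2 - bnorm B (z - v) ^+ 2
    + 2 * a * pairing g (y - z).
Proof.
move=> Bs Bp cvx [zD zmin] yD; set k := y - z.
have yE : y - v = (z - v) + k by rewrite /k [RHS]addrC addrA subrK.
pose f s := (a * pairing g k + pairing (B (z - v)) k)
  + s * (2^-1 * bnorm B k ^+ 2).
have : 0 <= f 0.
  apply: (continuous_ge0_at0 (f := f)) => [|s /andP[s0 s1]].
    apply: cvgD; first exact: cvg_cst.
    by apply: cvgM; [exact: cvg_id|exact: cvg_cst].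
  have s01 : 0 <= s <= 1 by rewrite ltW.
  have := zmin _ (cvx _ _ _ zD yD s01); rewrite -/k.
  rewrite [z + _ - v]addrAC (bnorm_sqrD Bs Bp (z - v)) bnorm_sqrZ//.
  rewrite (pairingDr _ (z - v)) !pairingZr.
  rewrite /f -(pmulr_rge0 _ s0) -mulr_natr. lra.
rewrite /f mul0r addr0 yE (bnorm_sqrD Bs Bp (z - v)) -mulr_natr. nra.
Qed.

End VariationalInequalities.

(** * Scalar inequalities behind [gamma_hat] and [alpha] *)

Section Scalars.
Context (R : realType).

Lemma weighted_am_gm (x y w1 w2 : R) : 0 <= x -> 0 <= y -> 0 < w1 -> 0 < w2 ->
  w1 + w2 = 1 -> x `^ w1 * y `^ w2 <= w1 * x + w2 * y.
Proof.
move=> x0 y0 w10 w20 w1D.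
have := @conjugate_powR R (x `^ w1) (y `^ w2) w1^-1 w2^-1.
rewrite !powR_ge0 !invr_gt0 !invrK => /(_ isT isT w10 w20 w1D).
by rewrite -!powRrM !divff ?gt_eqF// !powRr1// (mulrC x) (mulrC y).
Qed.

(** In the application n is the dual norm of the residual and D the distance from the tensor step to
    the solution. Weighted AM-GM with weights 2/(p+2) and p/(p+2) turns D^(p+2) into D^2 and leaves
    a and n only through a^(p+1) n^p. *)
Lemma alpha_young p (M Mhat sigma a n D : R) :
  0 < sigma -> 0 <= a -> 0 <= n -> 0 <= D -> 0 <= gamma_hat p M Mhat ->
  gamma_hat p M Mhat ^+ p.+1 <= a ^+ p.+1 * n ^+ p ->
  alpha p M Mhat sigma * D ^+ 2 <=
    2 * a * sigma * D ^+ p.+2 + a ^+ 2 * n ^+ 2.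
Proof.
rewrite /alpha; move: (gamma_hat p M Mhat) => c s0 a0 n0 D0 c0.
(* For p = 0 the second weight would vanish; there [alpha] is 2 c sigma and the hypothesis reads c
   <= a. *)
case: p => [|q]; first rewrite /= !expr1 expr0 !mulr1 => ca.
  rewrite divff ?pnatr_eq0// powRr1 ?(ltW s0)//.
  have := ler_wpM2r (mulr_ge0 (ltW s0) (sqr_ge0 D)) ca.
  have := mulr_ge0 (sqr_ge0 a) (sqr_ge0 n).
  lra.
set p := q.+1 => ca; rewrite /=.
have p0 : 0 < p%:R :> R by rewrite ltr0n.
have p20 : 0 < p.+2%:R :> R by rewrite ltr0n.
have p2E : p.+2%:R = p%:R + 2 :> R by rewrite -addn2 natrD.
set w1 : R := 2 / p.+2%:R; set w2 : R := p%:R / p.+2%:R.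
have w10 : 0 < w1 by rewrite divr_gt0.
have w20 : 0 < w2 by rewrite divr_gt0.
have w1D : w1 + w2 = 1 by rewrite -mulrDl addrC -p2E divff ?gt_eqF.
(* This scaling makes the weighted mean equal to half of the right-hand side: w1 d = 1 and w2 d / p
   = 1/2. *)
pose d : R := p.+2%:R / 2.
have d0 : 0 < d by rewrite divr_gt0.
have := @weighted_am_gm (d * (a * sigma * D ^+ p.+2))
  (d * (p%:R^-1 * (a * n) ^+ 2)) w1 w2.
have X0 := mulr_ge0 (mulr_ge0 a0 (ltW s0)) (exprn_ge0 p.+2 D0).
move=> /(_ (mulr_ge0 (ltW d0) X0)).
rewrite !mulr_ge0 ?sqr_ge0 ?invr_ge0 ?(ltW d0) ?(ltW p0)//.
move=> /(_ isT w10 w20 w1D).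
have -> : w1 * (d * (a * sigma * D ^+ p.+2)) +
    w2 * (d * (p%:R^-1 * (a * n) ^+ 2)) =
    (2 * a * sigma * D ^+ p.+2 + a ^+ 2 * n ^+ 2) / 2.
  by rewrite /w1 /w2 /d; field; rewrite !gt_eqF.
rewrite ler_pdivlMr//; apply: le_trans.
have D2 : (D ^+ p.+2) `^ w1 = D ^+ 2.
  rewrite -!powR_mulrn// -powRrM; congr (_ `^ _).
  by rewrite mulrC divfK ?gt_eqF.
have an : a `^ w1 * ((a * n) ^+ 2) `^ w2 = (a ^+ p.+1 * n ^+ p) `^ w1.
  rewrite [a ^+ p.+1]exprS -mulrA -exprMn.
  rewrite [RHS]powRM ?exprn_ge0 ?mulr_ge0//; congr (_ * _).
  rewrite -(powR_mulrn 2 (mulr_ge0 a0 n0)) -(powR_mulrn p (mulr_ge0 a0 n0)).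
  by rewrite -!powRrM /w1 /w2 mulrCA.
have cE : c * c `^ w2 = (c ^+ p.+1) `^ w1.
  rewrite -powR_mulrn// -powRrM -[X in X * _]powRr1// -powRD; last first.
    by rewrite gt_eqF// addr_gt0.
  congr (_ `^ _); rewrite /w1 /w2 p2E -[p.+1%:R]natr1; field.
  by rewrite -p2E gt_eqF.
have -> : (d * (a * sigma * D ^+ p.+2)) `^ w1 =
    d `^ w1 * (a `^ w1 * sigma `^ w1 * D ^+ 2).
  rewrite -D2; have : 0 <= D ^+ p.+2 by rewrite exprn_ge0.
  move: (D ^+ p.+2) => z z0.
  by rewrite !powRM ?mulr_ge0 ?(ltW s0) ?(ltW d0).
have -> : (d * (p%:R^-1 * (a * n) ^+ 2)) `^ w2 =
    d `^ w2 * (p%:R^-1 `^ w2 * ((a * n) ^+ 2) `^ w2).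
  move: (_ ^+ 2) (sqr_ge0 (a * n)) => z z0.
  by rewrite !powRM ?mulr_ge0 ?invr_ge0 ?(ltW p0) ?(ltW d0).
have dE : d `^ w1 * d `^ w2 = d.
  by rewrite -powRD w1D ?powRr1 ?(ltW d0) ?oner_eq0.
rewrite powRM ?invr_ge0 ?(ltW p0)//.
(* Both sides are w1-th powers, of c^(p+1) and of a^(p+1) n^p, so the hypothesis applies by
   monotonicity. *)
have key : c * c `^ w2 <= a `^ w1 * ((a * n) ^+ 2) `^ w2.
  rewrite cE an; apply: ge0_ler_powR => //; first exact: ltW.
    by rewrite nnegrE exprn_ge0.
  by rewrite nnegrE mulr_ge0 ?exprn_ge0.
set t := p%:R^-1 `^ w2; set u := sigma `^ w1.
rewrite [leLHS](_ : _ = p.+2%:R * t * u * D ^+ 2 * (c * c `^ w2)); last by ring.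
rewrite [leRHS](_ : _ = (d `^ w1 * d `^ w2) * 2 * t * u * D ^+ 2 *
   (a `^ w1 * ((a * n) ^+ 2) `^ w2)); last by ring.
rewrite dE /d divfK ?pnatr_eq0//.
by rewrite ler_wpM2l// !mulr_ge0 ?powR_ge0 ?exprn_ge0 ?(ltW p20).
Qed.

(** The power p+1 clears the fractional exponent, so the step size can be bounded with integer
    powers only. *)
Lemma gamma_hat_expr p (M Mhat : R) : 0 <= M + Mhat / p.+1`!%:R ->
  gamma_hat p M Mhat ^+ p.+1 =
  (M - Mhat / p.+1`!%:R) ^+ p.+1 / (M + Mhat / p.+1`!%:R) ^+ p.+2.
Proof.
move=> S0; rewrite /gamma_hat exprMn -[X in _ * X]powR_mulrn ?powR_ge0//.
rewrite -powRrM mulNr divfK ?pnatr_eq0// -powR_invn//.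
Qed.

End Scalars.

(** * One iteration contracts the squared distance to the solution *)

Section ContractionStep.
Context (R : realType).

(** Eliminates r: raise the bound on n to the power p+2 and the bound on s to the power p+1, so that
    both contain r^((p+1)(p+2)). *)
Lemma step_size_lower_bound p (a b r s n : R) : 0 <= a -> 0 < b -> 0 <= r ->
  0 < n -> n <= b * r ^+ p.+1 -> a * r ^+ p.+2 <= s ->
  a ^+ p.+1 / b ^+ p.+2 <= (s / n ^+ 2) ^+ p.+1 * n ^+ p.
Proof.
move=> a0 b0 r0 n0 nb sa.
have s0 : 0 <= s by apply: le_trans sa; rewrite mulr_ge0 ?exprn_ge0.
have -> : (s / n ^+ 2) ^+ p.+1 * n ^+ p = s ^+ p.+1 / n ^+ p.+2.
  rewrite expr_div_n -exprM -mulrA; congr (_ * _).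
  have -> : (2 * p.+1 = p + p.+2)%N by lia.
  rewrite exprD invfM mulrC mulrA divff ?mul1r//.
  by rewrite expf_neq0// gt_eqF.
rewrite ler_pdivrMr ?exprn_gt0// mulrAC ler_pdivlMr ?exprn_gt0//.
apply: (@le_trans _ _ (a ^+ p.+1 * (b * r ^+ p.+1) ^+ p.+2)).
  rewrite ler_wpM2l ?exprn_ge0// lerXn2r// ?nnegrE ?(ltW n0)//.
  exact: le_trans (ltW n0) nb.
rewrite exprMn -exprM [(p.+1 * _)%N]mulnC exprM mulrCA mulrC -exprMn.
rewrite ler_wpM2r ?exprn_ge0 ?(ltW b0)//.
by rewrite lerXn2r// nnegrE mulr_ge0// exprn_ge0.
Qed.

Lemma mhat_fact_le p (M Mhat : R) : 0 < Mhat -> Mhat / p`!%:R <= M ->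
  Mhat / p.+1`!%:R <= M.
Proof.
move=> Mh0; apply: le_trans; rewrite ler_pM2l//.
rewrite lef_pV2 ?posrE ?ltr0n ?fact_gt0//.
by rewrite ler_nat factS leq_pmull.
Qed.

Lemma gamma_hat_ge0 p (M Mhat : R) : Mhat / p.+1`!%:R <= M ->
  0 <= gamma_hat p M Mhat.
Proof. by move=> LM; rewrite mulr_ge0 ?powR_ge0 ?subr_ge0. Qed.

Lemma alpha_ge0 p (M Mhat sigma : R) : Mhat / p.+1`!%:R <= M ->
  0 <= alpha p M Mhat sigma.
Proof.
move=> /gamma_hat_ge0; rewrite /alpha; move: (gamma_hat p M Mhat) => c c0.
by case: (p == 0%N); rewrite !mulr_ge0 ?powR_ge0 ?ler01.
Qed.

Context (E : vectType R) (B : 'Hom(E, dual E)).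
Hypothesis B_self_adjoint : self_adjoint B.
Hypothesis B_posdef : positive_definite B.

(** Convexity of the squared norm: the gap is a nonnegative multiple of a |x - y|^2. *)
Lemma bnorm_sqr_average (a : R) x y : 0 <= a ->
  bnorm B ((1 + a)^-1 *: (x + a *: y)) ^+ 2 <=
    (1 + a)^-1 * (bnorm B x ^+ 2 + a * bnorm B y ^+ 2).
Proof.
move=> a0; have a1 : 0 < 1 + a by rewrite ltr_pwDl.
rewrite bnorm_sqrZ// expr2 -mulrA ler_pM2l ?invr_gt0// ler_pdivrMl//.
rewrite (bnorm_sqrD B_self_adjoint B_posdef) bnorm_sqrZ// pairingZr.
have := mulr_ge0 a0 (sqr_ge0 (bnorm B (x - y))).
rewrite (bnorm_sqrD B_self_adjoint B_posdef) bnormN// pairingNr !mulr2n. lra.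
Qed.

Context (psi : E -> \bar R) (psi_pcc : proper_closed_convex psi).
Context (p : nat) (U : set E) (V : E -> dual E).
Hypothesis dom_sub_U : edom psi `<=` U.
Hypothesis V_smooth : Ck_on p.+1 U V.
Context (sigma Mhat M : R).
Hypotheses (sigma_gt0 : 0 < sigma) (Mhat_gt0 : 0 < Mhat).
Hypothesis V_mono : uniformly_monotone B psi V p.+2 sigma.
Hypothesis V_bound : forall x, edom psi x ->
  (opnorm B (Diter p.+1 V x) <= Mhat%:E)%E.
Hypothesis M_ge : Mhat / p.+1`!%:R <= M.

(** Constant of the Taylor remainder; [gamma_hat] is (M - L) (M + L)^(-(p+2)/(p+1)). *)
Let L : R := Mhat / p.+1`!%:R.
Let L_gt0 : 0 < L. Proof. by rewrite divr_gt0 ?ltr0n ?fact_gt0. Qed.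
Let M_ge0 : 0 <= M. Proof. exact: le_trans (ltW L_gt0) M_ge. Qed.

Section Residual.
Context (v xp : E).
Hypotheses (v_dom : edom psi v) (xp_dom : edom psi xp).

Let g := Vpsi B V p M v xp.
Let delta := V xp - taylor V p v xp.
Let r := bnorm B (xp - v).

Let delta_le : dnorm B delta <= L * r ^+ p.+1.
Proof.
have := taylor_remainder_le B_self_adjoint B_posdef (U := U) (V := V) (p := p)
  (C := Mhat) (v := v) (h := xp - v).
rewrite [v + (xp - v)]addrC subrK; apply => //; first exact: ltW.
  by move=> s s01; apply/dom_sub_U/edom_convex.
by move=> s s01; apply/V_bound/edom_convex.
Qed.

Let pairing_residual x :
  pairing g x = pairing delta x - M * r ^+ p * pairing (B (xp - v)) x.
Proof.
rewrite /g /Vpsi /tensor_model /delta !(pairingDl, pairingNl, pairingZl).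
by rewrite opprD addrA.
Qed.

(** Triangle inequality: the Taylor error contributes L r^(p+1) and the regularisation M r^p r. *)
Lemma residual_dnorm_le : dnorm B g <= (M + L) * r ^+ p.+1.
Proof.
apply: dualnorm_le => // [|x].
  by rewrite mulr_ge0 ?exprn_ge0 ?bnorm_ge0// addr_ge0// ltW.
rewrite pairing_residual addrC mulrDl mulrDl lerD//.
  apply: le_trans (ler_norm _) _.
  rewrite normrN normrM normrM normrX (ger0_norm (bnorm_ge0 _ _)).
  rewrite (ger0_norm M_ge0) exprSr mulrA -[leRHS]mulrA.
  rewrite ler_wpM2l ?mulr_ge0 ?exprn_ge0 ?bnorm_ge0//.
  exact: cauchy_schwarz.
apply: le_trans (ler_norm _) _.
apply: le_trans (pairing_le_dnorm _ _ _ _) _ => //.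
by rewrite ler_wpM2r ?bnorm_ge0.
Qed.

(** Against v - xp the regularisation contributes exactly M r^(p+2), while the Taylor error costs at
    most L r^(p+2). *)
Lemma residual_pairing_ge : (M - L) * r ^+ p.+2 <= pairing g (v - xp).
Proof.
rewrite -[v - xp]opprB pairingNr pairing_residual -bnorm_sqr// -/r.
rewrite opprB mulrBl lerD//.
  by rewrite -mulrA -exprD addn2.
rewrite lerN2; apply: le_trans (ler_norm _) _.
apply: le_trans (pairing_le_dnorm _ _ _ _) _ => //.
by rewrite (exprSr r p.+1) mulrA ler_wpM2r ?bnorm_ge0.
Qed.

Lemma step_size_ge : g != 0 ->
  gamma_hat p M Mhat ^+ p.+1 <= step_size B V p M v xp ^+ p.+1 * dnorm B g ^+ p.
Proof.
move=> g0; have ML : 0 < M + L by rewrite ltr_wpDl.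
rewrite gamma_hat_expr ?(ltW ML)//.
apply: (@step_size_lower_bound _ _ _ r) => //.
- by rewrite subr_ge0.
- exact: bnorm_ge0.
- exact: (dualnorm_gt0 B_self_adjoint B_posdef g0).
- exact: residual_dnorm_le.
- exact: residual_pairing_ge.
Qed.

End Residual.

(* The residual is the value at xp of V + psi', with psi' a subgradient of psi;
   it inherits the uniform monotonicity of V. *)
Lemma residual_monotone v xp xs : composite_VI_solution psi V xs ->
  is_tensor_step B psi V p M v xp ->
  sigma * bnorm B (xp - xs) ^+ p.+2 <= pairing (Vpsi B V p M v xp) (xp - xs).
Proof.
move=> xs_sol [xp_dom xp_step].
have xs_dom : edom psi xs by case: xs_sol.
have := xp_step _ xs_dom.
rewrite (psi_fine psi_pcc xp_dom) (psi_fine psi_pcc xs_dom) -EFinD lee_fin.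
have := minty psi_pcc dom_sub_U V_smooth xs_sol xp_dom.
have := V_mono xp_dom xs_dom.
rewrite /Vpsi; move: (tensor_model _ _ _ _ _ _) => G.
rewrite -[xs - xp]opprB pairingNr !pairingDl !pairingNl. lra.
Qed.

Lemma contraction_step v xp vhat xs :
  edom psi v -> composite_VI_solution psi V xs ->
  is_tensor_step B psi V p M v xp -> Vpsi B V p M v xp != 0 ->
  is_prox_step B psi V p M v xp vhat ->
  let a := alpha p M Mhat sigma in
  let v' := (1 + a)^-1 *: (vhat + a *: xp) in
  edom psi v' /\
  bnorm B (v' - xs) ^+ 2 <= (1 + a)^-1 * bnorm B (v - xs) ^+ 2.
Proof.
move=> v_dom xs_sol xp_step g0 vhat_step al v'.
have al0 : 0 <= al by exact: alpha_ge0.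
have al1 : 0 < 1 + al by rewrite ltr_pwDl.
have xp_dom : edom psi xp by case: xp_step.
have xs_dom : edom psi xs by case: xs_sol.
have vhat_dom : edom psi vhat by case: vhat_step.
split.
  (* The new point lies on the segment from vhat to xp, hence in the convex domain. *)
  have -> : v' = vhat + (al / (1 + al)) *: (xp - vhat).
    rewrite /v' scalerDr scalerA scalerBr [LHS]addrC [RHS]addrCA.
    rewrite [_^-1 * al]mulrC; congr (_ + _).
    rewrite -[X in _ = X - _]scale1r -scalerBl; congr (_ *: _).
    by field; rewrite gt_eqF.
  apply: edom_convex => //; rewrite divr_ge0 ?(ltW al1)//=.
  by rewrite ler_pdivrMr// mul1r lerDr.
have -> : v' - xs = (1 + al)^-1 *: ((vhat - xs) + al *: (xp - xs)).
  have xsE : xs = (1 + al)^-1 *: ((1 + al) *: xs).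
    by rewrite scalerA mulVf ?scale1r// gt_eqF.
  rewrite /v' {1}xsE -scalerBr; congr (_ *: _).
  by rewrite scalerDl scale1r scalerBr opprD addrACA.
apply: le_trans (bnorm_sqr_average _ _ al0) _.
rewrite ler_pM2l ?invr_gt0//.
set g := Vpsi B V p M v xp in g0 *.
set a := step_size B V p M v xp.
have n0 : 0 < dnorm B g by exact: (dualnorm_gt0 B_self_adjoint B_posdef g0).
have a0 : 0 <= a.
  rewrite divr_ge0 ?sqr_ge0//.
  apply: le_trans (residual_pairing_ge v_dom xp_dom).
  by rewrite mulr_ge0 ?exprn_ge0 ?bnorm_ge0 ?subr_ge0.
have prox := prox_step_ineq B_self_adjoint B_posdef
  (fun x y s => @edom_convex _ _ _ psi_pcc x y s) vhat_step xs_dom.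
have young := alpha_young sigma_gt0 a0 (ltW n0) (bnorm_ge0 B (xp - xs))
  (gamma_hat_ge0 M_ge) (step_size_ge v_dom xp_dom g0).
have mono := ler_wpM2l a0 (residual_monotone xs_sol xp_step).
(* The step size is chosen for exactly this identity. *)
have sE : a * pairing g (v - xp) = a ^+ 2 * dnorm B g ^+ 2.
  by rewrite /a /step_size -/g; field; rewrite gt_eqF.
(* The square of the proximal displacement produced here cancels against the negative one in
   [prox]. *)
have amgm : 2 * (a * pairing g (v - vhat)) <=
    a ^+ 2 * dnorm B g ^+ 2 + bnorm B (vhat - v) ^+ 2.
  have cs := pairing_le_dnorm B_self_adjoint B_posdef g (v - vhat).
  have := ler_wpM2l a0 (le_trans (ler_norm _) cs).
  rewrite -[v - vhat]opprB bnormN// pairingNr.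
  have := sqr_ge0 (a * dnorm B g - bnorm B (vhat - v)). nra.
(* The three parts are controlled by monotonicity of the residual, by the step size and by [amgm];
   together they leave -2 a sigma D^(p+2) - a^2 |g|^2, which [young] bounds by -alpha D^2. *)
have dec : a * pairing g (xs - vhat) = - (a * pairing g (xp - xs))
    - a * pairing g (v - xp) + a * pairing g (v - vhat).
  by rewrite !(pairingDr, pairingNr); ring.
move: prox young mono; rewrite -/g -/a -mulrA dec sE.
rewrite -[xs - vhat]opprB -[xs - v]opprB !bnormN// -/al. lra.
Qed.

End ContractionStep.

(** * The linear rate, by iterating the contraction *)

Theorem theorem6 (R : realType) (E : vectType R)
    (B : 'Hom(E, dual E))
    (B_self_adjoint : self_adjoint B) (B_posdef : positive_definite B)
    (psi : E -> \bar R) (psi_pcc : proper_closed_convex psi)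
    (p : nat)
    (U : set E) (U_open : open (U : set (topvect E)))
    (dom_sub_U : edom psi `<=` U)
    (V : E -> dual E) (V_smooth : Ck_on p.+1 U V)
    (sigma Mhat : R) (sigma_gt0 : 0 < sigma) (Mhat_gt0 : 0 < Mhat)
    (V_mono : uniformly_monotone B psi V p.+2 sigma)
    (V_bound : forall x, edom psi x ->
       (opnorm B (Diter p.+1 V x) <= Mhat%:E)%E)
    (M : R) (M_ge : Mhat / p`!%:R <= M)
    (x v vhat : nat -> E)
    (x0_dom : edom psi (x 0%N)) (v0_eq : v 0%N = x 0%N)
    (x_step : forall t, is_tensor_step B psi V p M (v t) (x t.+1))
    (Vpsi_neq0 : forall t, Vpsi B V p M (v t) (x t.+1) != 0)
    (vhat_step : forall t,
       is_prox_step B psi V p M (v t) (x t.+1) (vhat t.+1))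
    (v_step : forall t,
       v t.+1 = (1 + alpha p M Mhat sigma)^-1 *:
                  (vhat t.+1 + alpha p M Mhat sigma *: x t.+1))
    (xs : E) (xs_sol : composite_VI_solution psi V xs) (t : nat) :
  bnorm B (v t - xs) <=
    (1 / (1 + alpha p M Mhat sigma)) `^ (t%:R / 2) * bnorm B (x 0%N - xs).
Proof.
set q := alpha p M Mhat sigma.
have LM := mhat_fact_le Mhat_gt0 M_ge.
have q0 : 0 <= q by exact: alpha_ge0.
have q1 : 0 < 1 + q by rewrite ltr_pwDl.
(* Domain membership is carried along because the next Taylor bound is taken on the segment from v k
   to x k.+1. *)
have inv k : edom psi (v k) /\
    bnorm B (v k - xs) ^+ 2 <= (1 / (1 + q)) ^+ k * bnorm B (x 0%N - xs) ^+ 2.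
  elim: k => [|k [vk_dom IH]]; first by rewrite v0_eq expr0 mul1r.
  have [] := contraction_step B_self_adjoint B_posdef psi_pcc dom_sub_U V_smooth
    sigma_gt0 Mhat_gt0 V_mono V_bound LM vk_dom xs_sol (x_step k) (Vpsi_neq0 k)
    (vhat_step k).
  rewrite -/q -v_step => vk1_dom vk1_le; split=> //; apply: le_trans vk1_le _.
  by rewrite div1r [_ ^+ k.+1]exprS -mulrA -div1r ler_wpM2l// divr_ge0// ltW.
have b0 : 0 <= 1 / (1 + q) by rewrite divr_ge0// ltW.
(* Squaring turns the real exponent t/2 into the integer power t of the invariant. *)
rewrite -(ler_pXn2r (n := 2)) ?nnegrE ?mulr_ge0 ?powR_ge0 ?bnorm_ge0//.
rewrite exprMn -[(_ `^ _) ^+ 2]powR_mulrn ?powR_ge0//.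
rewrite -powRrM divfK ?pnatr_eq0//.
by rewrite powR_mulrn//; case: (inv t).
Qed.
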